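(* Let $\lambda\in[-1,1]$ be real. For any $g\in\mathrm{Hier}(\mathbb{T})$ there is a bounded operator $\sigma(g)$ in $H_\lambda$ such that $\sigma(g)\phi_v=\phi_{gv}$ (for $v\in\mathrm{vert}(\mathbb{T})$). Moreover, $\sigma(g)$ can be represented in the form $$\sigma(g)=U(1+Q),$$ where $U$ is a unitary operator and $Q$ has finite rank.
   Context: $\mathbb{T}$ is the tree (unique up to isomorphism) in which every vertex has countably infinite valence. A subtree $S\subset\mathbb{T}$ isomorphic to $\mathbb{T}$ is a $(\mathbb{T})$-subtree if only finitely many edges $[a,b]$ of $\mathbb{T}$ satisfy $a\in S$, $b\notin S$. A $(\mathbb{T})$-covering forest is a finite collection of pairwise disjoint $(\mathbb{T})$-subtrees obtained from $\mathbb{T}$ by removing a finite collection of edges (keeping all vertices). A spheromorphism $g$ is given by two $(\mathbb{T})$-covering forests $S_1,\dots,S_k$ and $R_1,\dots,R_k$ and tree isomorphisms $g^{(j)}:S_j\to R_j$; it is identified with the induced permutation $v\mapsto gv$ of the vertex set $\mathrm{vert}(\mathbb{T})$. $\mathrm{Hier}(\mathbb{T})$ is the group of all spheromorphisms. Let $d(v,w)$ be the natural distance on $\mathrm{vert}(\mathbb{T})$. For real $\lambda\in[-1,1]$ the kernel $\lambda^{d(v,w)}$ is positive definite on $\mathrm{vert}(\mathbb{T})$ (for $\lambda=0$ it is $1$ if $v=w$ and $0$ otherwise), and $H_\lambda$ is the Hilbert space determined by it: a Hilbert space with a system of vectors $\phi_v$, $v\in\mathrm{vert}(\mathbb{T})$,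 such that $\langle\phi_v,\phi_w\rangle=\lambda^{d(v,w)}$ and linear combinations of the $\phi_v$ are dense in $H_\lambda$. The cases $\lambda=\pm1$, where $H_\lambda$ is one-dimensional, are called degenerate.
   Formalization: For λ = −1 the formal theorem additionally assumes that g preserves the parity of distances between vertices; without this no linear σ(g) with σ(g)φ_v = φ_{gv} exists, and the claim as printed fails there. All other λ in (−1,1] are covered as stated. *)

(* Defs.v *)
From HB Require Import structures.
From mathcomp Require Import all_boot all_order all_algebra.
From mathcomp Require Import complex.
From mathcomp Require Import all_classical all_reals all_analysis.

Set Implicit Arguments.
Unset Strict Implicit.
Unset Printing Implicit Defensive.

Import Order.TTheory GRing.Theory Num.Theory.
Import numFieldNormedType.Exports.

Local Open Scope classical_set_scope.
Local Open Scope ring_scope.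

Section Trees.
Variables (V : choiceType) (adj : rel V).

(* [cycle] accepts closed walks of length 1 and 2, hence the size condition. *)
Definition is_tree : Prop :=
  [/\ symmetric adj, irreflexive adj, inhabited V,
      forall v w, exists p : seq V, path adj v p /\ last v p = w
    & forall c : seq V, (2 < size c)%N -> ~ ucycle adj c].

(* The tree T of the text is any V, adj satisfying this predicate. *)
Definition is_treeT : Prop :=
  is_tree /\ forall v, ([set w | adj v w] #= [set: nat])%card.

Definition joined_by (v w : V) (n : nat) : Prop :=
  exists p : seq V, [/\ path adj v p, last v p = w & size p = n].

Lemma joined_by_asbool v w :
  (exists n, joined_by v w n) -> exists n, `[< joined_by v w n >].
Proof. by move=> [n vw]; exists n; apply/asboolP. Qed.

(* Length of a shortest walk; the value 0 for vertices that are not joined is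
   never met in a connected graph. *)
Definition gdist (v w : V) : nat :=
  match pselect (exists n, joined_by v w n) with
  | left h => ex_minn (joined_by_asbool h)
  | right _ => 0%N
  end.

Definition edges (S : set V) : set (set V) :=
  [set e | exists a b, [/\ S a, S b, adj a b & e = [set a; b]]].

(* Subtrees are represented by their vertex sets: a subtree of a tree is the
   subgraph induced on its vertices. *)
Definition tree_iso (S R : set V) (f : V -> V) : Prop :=
  set_bij S R f /\ forall x y, S x -> S y -> adj (f x) (f y) = adj x y.

Definition T_subtree (S : set V) : Prop :=
  (exists f, tree_iso setT S f) /\
  finite_set [set e : V * V | [/\ adj e.1 e.2, S e.1 & ~ S e.2]].

(* The last two clauses say that the disjoint union of the S j has all the
   vertices of the tree, and all its edges except those of E. *)
Definition covering_forest (k : nat) (S : 'I_k -> set V) : Prop :=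
  [/\ forall j, T_subtree (S j),
      trivIset setT S
    & exists E : set (set V),
        [/\ finite_set E, E `<=` edges setT,
            \bigcup_j S j = setT
          & \bigcup_j edges (S j) = edges setT `\` E]].

Definition Hier : set (V -> V) :=
  [set g | exists (k : nat) (S R : 'I_k -> set V) (h : 'I_k -> V -> V),
     [/\ covering_forest S, covering_forest R,
         forall j, tree_iso (S j) (R j) (h j)
       & forall j v, S j v -> g v = h j v]].

(* Only used for lambda = -1, where phi v is phi w or - phi w according to the
   parity of gdist adj v w: an operator with phi v |-> phi (g v) then exists
   only if g has this property.  Not every element of Hier does: remove an edge
   [a, b], let g fix the component of a and act on the component of b by an
   automorphism that moves b to a neighbour. *)
Definition preserves_parity (g : V -> V) : Prop :=
  forall v w, odd (gdist (g v) (g w)) = odd (gdist v w).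

End Trees.

Section Operators.
Variables (R : realType) (H : completeNormedModType R[i]).

(* H is a complex Hilbert space with inner product dot, linear in the first
   argument and conjugate-linear in the second. *)
Definition hilbert_dot (dot : {dot H for Num.conj}) : Prop :=
  forall x, dot x x = `|x| ^+ 2.

Definition bounded_operator (f : {linear H -> H}) : Prop :=
  bounded_near f (nbhs (0 : H)).

Definition unitary (dot : {dot H for Num.conj}) (U : {linear H -> H}) : Prop :=
  (forall x y, dot (U x) (U y) = dot x y) /\ set_surj setT setT U.

Definition finite_rank (Q : {linear H -> H}) : Prop :=
  exists (n : nat) (b : 'I_n -> H), forall x, exists c : 'I_n -> R[i],
    Q x = \sum_(i < n) c i *: b i.

Definition span (I : Type) (phi : I -> H) : set H :=
  [set x | exists (s : seq I) (c : I -> R[i]), x = \sum_(i <- s) c i *: phi i].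

(* H, with the vectors phi v, is the space H_lambda. *)
Definition is_Hlambda (V : choiceType) (adj : rel V) (lambda : R)
    (dot : {dot H for Num.conj}) (phi : V -> H) : Prop :=
  [/\ hilbert_dot dot,
      forall v w, dot (phi v) (phi w) = (lambda ^+ gdist adj v w)%:C%C
    & dense (span phi)].

End Operators.

(* Main.v *)
(* Root the tree at o, let p be the parent map and let |lambda| < 1.  The
   vectors e_v = phi_v - lambda phi_{p v} (v <> o) and
   e_o = sqrt (1 - lambda^2) phi_o are pairwise orthogonal, all of norm
   sqrt (1 - lambda^2), and total, so e_v |-> e_{g v} extends to a unitary
   operator U.  A spheromorphism g satisfies p (g v) = g (p v) for all but
   finitely many v: all but finitely many edges are preserved by g, and a
   preserved edge whose direction towards the root is reversed has its image on
   the path from g w to o, for one of finitely many w.  Hence U e_v is the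
   required image of e_v outside a finite set of v, and Q corrects U on that
   set.  For lambda = 1, and for lambda = -1 when g preserves the parity of
   distances, the map phi_v |-> phi_{g v} is already isometric. *)
From HB Require Import structures.
Require Import Defs.
From mathcomp Require Import all_boot all_order all_algebra.
From mathcomp Require Import complex.
From mathcomp Require Import all_classical all_reals all_analysis.

Import Order.TTheory GRing.Theory Num.Theory.
Import numFieldNormedType.Exports.

Local Open Scope classical_set_scope.
Local Open Scope ring_scope.

Set Implicit Arguments.
Unset Strict Implicit.
Unset Printing Implicit Defensive.

(** * Geometry of rooted trees *)

Section TreeGeometry.
Variables (V : choiceType) (adj : rel V).
Hypothesis tree : is_tree adj.

Lemma gdist_le v p : path adj v p -> (gdist adj v (last v p) <= size p)%N.
Proof.
move=> vp; rewrite /gdist; case: pselect => // h.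
by case: ex_minnP => n _; apply; apply/asboolP; exists p.
Qed.

Lemma gdist_walk v w :
  exists p, [/\ path adj v p, last v p = w & size p = gdist adj v w].
Proof.
rewrite /gdist; case: pselect => [h|[]].
  by case: ex_minnP => n /asboolP.
case: tree => _ _ _ connected _; have [p [vp pw]] := connected v w.
by exists (size p), p.
Qed.

Lemma gdist_geodesic v w : exists p,
  [/\ path adj v p, last v p = w, uniq (v :: p) & size p = gdist adj v w].
Proof.
have [p [vp pw sp]] := gdist_walk v w.
have := gdist_le; case: (shortenP vp) pw => q vq uq sub_qp qw le_gdist.
exists q; split=> //; apply/eqP; rewrite eqn_leq -{2}qw le_gdist // andbT -sp.
by apply: uniq_leq_size => //; case/andP: uq.
Qed.

Lemma gdistxx v : gdist adj v v = 0%N.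
Proof. by apply/eqP; rewrite -leqn0; exact: (@gdist_le v [::]). Qed.

Lemma gdist_eq0 v w : gdist adj v w = 0%N -> v = w.
Proof. by have [[|x q] [_ /= vw <-]] := gdist_walk v w. Qed.

Lemma gdist_adj v w u :
  adj v w -> (gdist adj v u <= (gdist adj w u).+1)%N.
Proof.
move=> vw; have [p [wp <- <-]] := gdist_walk w u.
by apply: (@gdist_le v (w :: p)); rewrite /= vw.
Qed.

Definition is_parent (o : V) (p : V -> V) : Prop :=
  forall v, v <> o -> adj v (p v) /\ (gdist adj (p v) o).+1 = gdist adj v o.

Lemma parent_exists o : exists p, is_parent o p.
Proof.
suff /choice[p parent_p] : forall v, exists u, v <> o ->
    adj v u /\ (gdist adj u o).+1 = gdist adj v o by exists p.
move=> v; have [->|vNo] := pselect (v = o); first by exists o.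
have [[|u q] [/= + qo sq]] := gdist_walk v o; first by case: vNo.
case/andP=> vu uq; exists u => _; split=> //; apply/eqP.
by rewrite eqn_leq gdist_adj // -sq ltnS -qo gdist_le.
Qed.

(** A walk from [v] to [w] avoiding the edge, once shortened, has at least three vertices, and the
    edge itself would close it to a cycle. *)
Lemma edge_is_bridge (v w : V) (e := [rel x y | [&& adj x y,
    (x, y) != (v, w) & (x, y) != (w, v)]]) q :
  adj v w -> path e v q -> last v q <> w.
Proof.
case: tree => adjC adjxx _ _ acyclic vw /shortenP[[|x [|y r]] vr ur _] rw.
- by move: vw; rewrite -rw /= adjxx.
- by move: vr rw => /= /andP[+ _] => /[swap] ->; rewrite eqxx andbF.
apply: (acyclic [:: v, x, y & r]) => //; rewrite /ucycle ur andbT.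
rewrite /cycle rcons_path rw adjC vw andbT.
by apply: sub_path vr => a b /and3P[].
Qed.

Section Rooted.
Variables (o : V) (p : V -> V).
Hypothesis parent : is_parent o p.

(** Otherwise no parent step uses the edge, so the chains of parents from [v] and from [w] to the
    root avoid it and join into a detour around a bridge. *)
Lemma parent_adj v w : adj v w -> (v <> o /\ p v = w) \/ (w <> o /\ p w = v).
Proof.
move=> vw; apply: contrapT => /not_orP[Nv Nw].
have [adjC _ _ _ _] := tree.
pose e := [rel x y | [&& adj x y, (x, y) != (v, w) & (x, y) != (w, v)]].
have eC : symmetric e.
  by move=> x y /=; rewrite (adjC x) !xpair_eqE (andbC (y == v)) (andbC (y == w));
    congr (_ && _); rewrite andbC.
have ep u : u <> o -> e u (p u).
  move=> uo; have [up _] := parent uo; apply/and3P; split=> //.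
    by apply/eqP => -[uv pu]; apply: Nv; rewrite -uv.
  by apply/eqP => -[uw pu]; apply: Nw; rewrite -uw.
have chain n u : gdist adj u o = n -> exists q, path e u q /\ last u q = o.
  elim: n u => [u /gdist_eq0 ->|n IHn u un]; first by exists [::].
  have uo : u <> o by move=> uo; move: un; rewrite uo gdistxx.
  have [|q [pq qo]] := IHn (p u).
    by apply: succn_inj; rewrite -un; case: (parent uo).
  by exists (p u :: q); split=> //; apply/andP; split=> //; exact: ep.
have [q [vq qo]] := chain _ v erefl; have [r [wr ro]] := chain _ w erefl.
have rw : path e o (rev (belast w r)).
  by rewrite -ro rev_path (eq_path (e' := e)) // => x y; rewrite -eC.
apply: (@edge_is_bridge v w (q ++ rev (belast w r)) vw).
  by rewrite cat_path vq qo.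
rewrite last_cat qo; case: r wr ro {rw} => [_ <- //|x r _ _ /=].
by rewrite rev_cons last_rcons.
Qed.

(* A walk without backtracking that does not start towards the root moves
   away from the root forever. *)
Lemma gdist_descend x q : path adj x q -> uniq (x :: q) ->
  (x <> o -> p x \notin q) ->
  gdist adj (last x q) o = (gdist adj x o + size q)%N.
Proof.
elim: q x => [|y q IHq] x /=; first by rewrite addn0.
move=> /andP[xy yq] /andP[xNq uq] pxN.
have [[xo pxy]|[yo pyx]] := parent_adj xy.
  by have := pxN xo; rewrite pxy mem_head.
rewrite IHq //; first by rewrite -(parent yo).2 pyx addSnnS.
by rewrite pyx; move: xNq; rewrite inE negb_or => /andP[].
Qed.

(** A geodesic from [v] that does not begin with [p v] moves away from the root and ends strictly
    deeper than [v], against the bound on [w]. *)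
Lemma gdist_parent v w : v <> o -> v <> w ->
  (gdist adj w o <= gdist adj v o)%N ->
  gdist adj v w = (gdist adj (p v) w).+1.
Proof.
move=> vo vw le_wv; have [vp _] := parent vo.
have [[|x q] [/= vq qw uq sq]] := gdist_geodesic v w; first by case: vw.
case/andP: vq => vx xq; apply/eqP; rewrite eqn_leq gdist_adj //= -sq ltnS.
have [pvx|xpv] := pselect (p v = x); first by rewrite pvx -qw gdist_le.
have [[_ /xpv//]|[xo pxv]] := parent_adj vx.
case/andP: uq; rewrite inE negb_or => /andP[_ vNq] uq.
move: le_wv; rewrite -qw gdist_descend //; last by rewrite pxv.
by rewrite -(parent xo).2 pxv addSn -ltn_subRL subnn.
Qed.

(* If [g] reverses the edge from [v] to its parent, it also reverses the next
   edge towards the root, unless [g] does not preserve that edge.  Hence the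
   image of a chain of reversed edges is a segment of the path from
   [g w] to the root, for some [w] in a finite set. *)
Lemma finite_reversed_edges (g gi : V -> V) (W : set V) :
  cancel g gi -> finite_set W ->
  (forall v, v <> o -> ~ W v -> adj (g v) (g (p v))) ->
  finite_set [set v | ~ [/\ v <> o, g v <> o & p (g v) = g (p v)]].
Proof.
move=> gK finW adj_g; pose W0 := W `|` [set o].
have ginj := can_inj gK.
have finW0 : finite_set W0 by rewrite finite_setU.
have reversed n v : gdist adj v o = n -> ~ W0 v ->
    ~ [/\ v <> o, g v <> o & p (g v) = g (p v)] ->
    exists w k, [/\ W0 w, g v = iter k p (g w)
                  & gdist adj (g w) o = (k + gdist adj (g v) o)%N].
  elim: n v => [v /gdist_eq0 vo NW|n IHn v vn NWv bad].
    by case: NW; right.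
  have vo : v <> o by move=> vo; apply: NWv; right.
  have /parent_adj gvpv : adj (g v) (g (p v)).
    by apply: adj_g => // Wv; apply: NWv; left.
  have [[gvo pgv]|[gpvo pgpv]] := gvpv; first by case: bad.
  have [_ dpv] := parent vo; have [_ dgpv] := parent gpvo.
  have [Wpv|NWpv] := pselect (W0 (p v)).
    by exists (p v), 1%N; rewrite add1n -pgpv dgpv.
  have [| //| |w [k [Ww gk dw]]] := IHn (p v).
  - by apply: succn_inj; rewrite -vn.
  (* If the edge above [p v] were not reversed, injectivity of [g] would give [p (p v) = v], which
     the depths forbid. *)
  - move=> [pvo _]; rewrite pgpv => /ginj vppv.
    have [_] := parent pvo; rewrite -vppv -dpv => /eqP.
    by rewrite -[X in _ == X]add0n -[X in X == _]/(2 + _)%N eqn_add2r.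
  by exists w, k.+1; rewrite /= -gk pgpv dw addSnnS -dgpv pgpv.
(* The depth equation leaves finitely many [k] for each [w], and [gi] recovers [v] from the pair. *)
apply: (@sub_finite_set _ _ (W0 `|` \bigcup_(w in W0)
  ((fun k => gi (iter k p (g w))) @` `I_(gdist adj (g w) o).+1))).
  move=> v bad; have [Wv|NWv] := pselect (W0 v); [by left|right].
  have [w [k [Ww gv dw]]] := reversed _ v erefl NWv bad.
  by exists w => //; exists k; rewrite /= ?ltnS ?dw ?leq_addr // -gv gK.
rewrite finite_setU; split=> //; apply: bigcup_finite => // w _.
exact/finite_image/finite_II.
Qed.

End Rooted.

(** * Spheromorphisms as permutations, and the edges they preserve *)

Lemma Hier_bij g : Hier adj g -> exists gi, cancel g gi /\ cancel gi g.
Proof.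
move=> [k [S [R [h [[_ Sdisj [E [_ _ Scov _]]]
  [_ Rdisj [E' [_ _ Rcov _]]] hiso gh]]]]].
have inS v : exists j, S j v.
  by have : [set: V] v by []; rewrite -Scov => -[j _]; exists j.
have ginj : injective g.
  move=> v w gvw; have [i Siv] := inS v; have [j Sjw] := inS w.
  have [[hiR hiI _] _] := hiso i; have [[hjR _ _] _] := hiso j.
  have ij : i = j.
    apply: (Rdisj i j) => //; exists (g v); split.
      by rewrite (gh i) //; exact: hiR.
    by rewrite gvw (gh j) //; exact: hjR.
  apply: hiI; rewrite ?inE //; first by rewrite ij.
  by rewrite -(gh i) // gvw (gh i) // ij.
have /choice[gi giK] : forall w, exists v, g v = w.
  move=> w; have : [set: V] w by [].
  rewrite -Rcov => -[j _ Rjw]; have [[_ _ hS] _] := hiso j.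
  by have [v Sv hv] := hS w Rjw; exists v; rewrite (gh j).
by exists gi; split=> // v; apply: ginj; rewrite giK.
Qed.

(** An edge outside [E] lies in a single tree [S j], where [g] agrees with the isomorphism [h j];
    only the edges of [E] can be broken. *)
Lemma Hier_adj g o p : Hier adj g -> is_parent o p ->
  finite_set [set v | v <> o /\ ~ adj (g v) (g (p v))].
Proof.
move=> [k [S [R [h [[_ Sdisj [E [finE _ _ SE]]] _ hiso gh]]]]] parent.
(* The root gets the empty set, which differs from every edge, so that [f] is injective. *)
pose f v := if v == o then set0 else [set v; p v].
have fE v : v <> o -> f v = [set v; p v] by move/eqP/negPf; rewrite /f => ->.
apply: (@sub_finite_set _ _ (f @^-1` E)).
  move=> v [vo Nadj]; apply: contrapT; rewrite /= fE // => NE; apply: Nadj.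
  have [vp _] := parent v vo.
  have : (edges adj setT `\` E) [set v; p v] by split=> //; exists v, (p v).
  rewrite -SE => -[j _ [a [b [Sa Sb ab vpab]]]].
  have Svp x : [set v; p v] x -> S j x by rewrite vpab => -[->|->].
  have [Sv Sp] : S j v /\ S j (p v) by split; apply: Svp; [left|right].
  by rewrite !(gh j) //; have [_ ->] := hiso j.
apply: finite_preimage finE => v w _ _.
have [->|vo] := pselect (v = o); have [->//|wo] := pselect (w = o).
- rewrite [f w]fE // /f eqxx => /seteqP[_ /(_ w)].
  by case; left.
- rewrite [f v]fE // /f eqxx => /seteqP[/(_ v) + _].
  by case; left.
rewrite !fE // => vpwp.
(* Two different vertices with the same parent edge would be parents of each other. *)
have : [set w; p w] v by rewrite -vpwp; left.
have : [set v; p v] w by rewrite vpwp; left.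
case=> [->//|wpv] [//|vpw].
have := (parent v vo).2; have := (parent w wo).2.
by rewrite -vpw -wpv => <- /eqP; rewrite -[X in _ == X]add0n
  -[X in X == _]/(2 + _)%N eqn_add2r.
Qed.

End TreeGeometry.

(** * Isometric extension and finite rank perturbation *)

Section HilbertSpace.
Variables (R : realType) (H : completeNormedModType R[i]).
Variable dot : {dot H for Num.conj}.
Hypothesis dotE : hilbert_dot dot.

Lemma norm_eq_dot x y : dot x x = dot y y -> `|x| = `|y|.
Proof. by rewrite !dotE => /eqP; rewrite eqrXn2 // => /eqP. Qed.

Lemma dot_cauchy_schwarz x e : `|dot x e| <= `|x| * `|e|.
Proof.
have [->|e0] := eqVneq e 0; first by rewrite linear0r !normr0 mulr0.
have ne : 0 < `|e| ^+ 2 by rewrite exprn_gt0 // normr_gt0.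
rewrite -(@ler_pXn2r _ 2) ?nnegrE ?mulr_ge0 // exprMn -ler_pdivrMr //.
(* The vector [a *: e] is the orthogonal projection of [x] to the line of [e]. *)
set c := dot x e; pose a := c / `|e| ^+ 2.
have : 0 <= dot (x - a *: e) (x - a *: e) by rewrite dotE exprn_ge0.
rewrite dnormB linearZr_LR linearZl_LR linearZr_LR /= !dotE -/c.
have aE : a^* * c = `|c| ^+ 2 / `|e| ^+ 2.
  by rewrite /a rmorphM /= fmorphV /= (geC0_conj (ltW ne)) normCK
    [c * _]mulrC mulrAC.
have -> : a^* * (a * `|e| ^+ 2) = a^* * c by rewrite divfK ?gt_eqF.
have dC : (`|c| ^+ 2 / `|e| ^+ 2)^* = `|c| ^+ 2 / `|e| ^+ 2.
  by apply: geC0_conj; rewrite divr_ge0 // ?exprn_ge0 // ltW.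
by rewrite aE dC opprD addrA addrK subr_ge0.
Qed.

(** The norm of [x + y] determines the real part of the inner product; replacing [y] by ['i *: y]
    yields the imaginary part. *)
Lemma dot_polarization (U : {linear H -> H}) :
  (forall z, dot (U z) (U z) = dot z z) ->
  forall x y, dot (U x) (U y) = dot x y.
Proof.
move=> Unorm x y.
have reE z t : dot (U z) (U t) + (dot (U z) (U t))^* = dot z t + (dot z t)^*.
  have := Unorm (z + t); rewrite linearD !dnormD !Unorm.
  by move/addrI.
have := reE x ('i *: y); rewrite linearZ !linearZr_LR /= !rmorphM /= conjCi.
rewrite rmorphN /= conjCi opprK !mulNr ![- _ + _]addrC -!mulrBr.
move/(mulfI (neq0Ci _)) => imE; have {}reE := reE x y.
apply: (@mulfI _ (2 : R[i])); first by rewrite pnatr_eq0.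
have two (a b : R[i]) : a + b - (b - a) = a + a.
  by rewrite opprB addrACA subrr addr0.
by rewrite !mulr_natl !mulr2n -(two _ (dot (U x) (U y))^* ) reE imE two.
Qed.

Lemma bounded_operator_le (f : {linear H -> H}) (r : R[i]) : 0 <= r ->
  (forall x, `|f x| <= r * `|x|) -> bounded_operator f.
Proof.
move=> r0 fr; apply/bounded_funP => M; exists (r * M) => x xM.
by rewrite (le_trans (fr x)) // ler_wpM2l.
Qed.

(** The list of coefficients does not depend on the family, so the same [l] can be evaluated on two
    families; concatenation of lists is addition. *)
Definition lcomb (I : Type) (a : I -> H) (l : seq (R[i] * I)) : H :=
  \sum_(q <- l) q.1 *: a q.2.

Definition total (I : Type) (a : I -> H) : Prop :=
  forall x e, 0 < e -> exists l, `|x - lcomb a l| < e.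

Lemma lcomb_cat I (a : I -> H) l l' : lcomb a (l ++ l') = lcomb a l + lcomb a l'.
Proof. by rewrite /lcomb big_cat. Qed.

Lemma lcombZ I (a : I -> H) k l :
  lcomb a [seq (k * q.1, q.2) | q <- l] = k *: lcomb a l.
Proof.
by rewrite /lcomb big_map scaler_sumr; apply: eq_bigr => q _; rewrite scalerA.
Qed.

Lemma lcomb1 I (a : I -> H) i : lcomb a [:: (1, i)] = a i.
Proof. by rewrite /lcomb big_seq1 scale1r. Qed.

Lemma dense_total I (a : I -> H) : dense (Defs.span a) -> total a.
Proof.
move=> da x e e0.
have [|y [xy [s [c yE]]]] := da (ball x e) _ (@ball_open _ _ x e).
  by exists x; apply: ballxx.
exists [seq (c i, i) | i <- s]; move: xy; rewrite -ball_normE yE /=.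
by rewrite /lcomb big_map.
Qed.

Lemma total_span I J (a : I -> H) (b : J -> H) :
  total a -> (forall i, exists l, a i = lcomb b l) -> total b.
Proof.
move=> ta ab x e e0; have [l xl] := ta x e e0.
suff [l' ll'] : exists l', lcomb a l = lcomb b l' by exists l'; rewrite -ll'.
elim: l {xl} => [|[k i] l [l' ll']]; first by exists [::]; rewrite /lcomb !big_nil.
have [m im] := ab i; exists ([seq (k * q.1, q.2) | q <- m] ++ l').
by rewrite lcomb_cat lcombZ -im -ll' /lcomb big_cons.
Qed.

Section Extension.
Variables (I : Type).
Implicit Types a b : I -> H.

(* The closure of the graph of the map taking [lcomb a l] to [lcomb b l]. *)
Definition ext_graph a b (x y : H) : Prop := forall e, 0 < e ->
  exists l, `|x - lcomb a l| < e /\ `|y - lcomb b l| < e.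

Definition same_gram a b : Prop :=
  forall i j, dot (a i) (a j) = dot (b i) (b j).

Lemma norm_lcomb a b l : same_gram a b -> `|lcomb a l| = `|lcomb b l|.
Proof.
move=> ab; apply: norm_eq_dot; rewrite /lcomb !linear_sumlz.
apply: eq_bigr => q _; rewrite !linear_sumr; apply: eq_bigr => r _.
by rewrite !linearZl_LR !linearZr_LR /= ab.
Qed.

Lemma norm_lcombB a b l l' : same_gram a b ->
  `|lcomb a l - lcomb a l'| = `|lcomb b l - lcomb b l'|.
Proof.
move=> ab; rewrite -[- lcomb a l']scaleN1r -[- lcomb b l']scaleN1r.
by rewrite -!lcombZ -!lcomb_cat; exact: norm_lcomb.
Qed.

Lemma ext_graph_sym a b x y : ext_graph a b x y -> ext_graph b a y x.
Proof. by move=> xy e /xy[l [? ?]]; exists l. Qed.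

Lemma ext_graph_linear a b k x y x' y' : ext_graph a b x y ->
  ext_graph a b x' y' -> ext_graph a b (k *: x + x') (k *: y + y').
Proof.
move=> xy x'y' e e0; pose d := e / (`|k| + 1).
have k1 : 0 < `|k| + 1 by rewrite ltr_wpDl.
have d0 : 0 < d by rewrite divr_gt0.
have [l [xl yl]] := xy d d0; have [l' [xl' yl']] := x'y' d d0.
have dE : e = `|k| * d + d.
  by rewrite -[X in _ + X]mul1r -mulrDl mulrC divfK // gt_eqF.
exists ([seq (k * q.1, q.2) | q <- l] ++ l').
rewrite !lcomb_cat !lcombZ.
by split; rewrite opprD addrACA -scalerBr (le_lt_trans (ler_normD _ _)) //
  normrZ dE ler_ltD // ler_wpM2l // ltW.
Qed.

Lemma ext_graph_norm_le a b x y : same_gram a b -> ext_graph a b x y ->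
  `|x| <= `|y|.
Proof.
move=> ab xy; apply/ler_addgt0Pr => e e0.
have [l [xl yl]] := xy (e / 2) ltac:(by rewrite divr_gt0).
rewrite -[x](subrK (lcomb a l)) (le_trans (ler_normD _ _)) //.
rewrite (norm_lcomb _ ab) -[X in `|X| + _]opprK normrN.
rewrite -[lcomb b l](subrK y) (le_trans (lerD (lexx _) (ler_normD _ _))) //.
rewrite addrA addrC lerD2l [e]splitr lerD //; apply: ltW => //.
  by rewrite -normrN opprK.
by rewrite distrC.
Qed.

Lemma ext_graph_norm a b x y : same_gram a b -> ext_graph a b x y ->
  `|x| = `|y|.
Proof.
move=> ab xy; apply: le_anti; rewrite (ext_graph_norm_le ab xy) /=.
by apply: ext_graph_norm_le (ext_graph_sym xy) => i j; rewrite ab.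
Qed.

Lemma ext_graph_fun a b x y y' : same_gram a b -> ext_graph a b x y ->
  ext_graph a b x y' -> y = y'.
Proof.
move=> ab xy xy'; have /(ext_graph_norm ab) := ext_graph_linear (-1) xy xy'.
rewrite !scaleN1r addNr normr0 => /esym/eqP; rewrite normr_eq0 addrC.
by rewrite subr_eq0 => /eqP.
Qed.

(** The images of combinations approximating [x] form a Cauchy filter, because equal Gram matrices
    make their differences as small as those of the combinations; completeness gives [y]. *)
Lemma ext_graph_total a b x : same_gram a b -> total a ->
  exists y, ext_graph a b x y.
Proof.
move=> ab ta.
pose B e := [set y | exists l, `|x - lcomb a l| < e /\ y = lcomb b l].
pose F := filter_from [set e : R[i] | 0 < e] B.
have FF : ProperFilter F.
  apply: filter_from_proper; last first.
    by move=> e /= e0; have [l xl] := ta x e e0; exists (lcomb b l), l.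
  apply: filter_from_filter; first by exists 1 => /=.
  have Bsub e d : e <= d -> B e `<=` B d.
    by move=> ed y [l [xl yl]]; exists l; split=> //; exact: lt_le_trans ed.
  move=> e d /= e0 d0.
  have [ed|de] := real_leP (gtr0_real e0) (gtr0_real d0).
    by exists e => // y Bey; split=> //; exact: Bsub Bey.
  by exists d => // y Bdy; split=> //; apply: Bsub Bdy; exact: ltW.
have /cauchy_cvgP/cvg_ex[y Fy] : cauchy F.
  apply: cauchy_exP => e e0; have e20 : 0 < e / 2 by rewrite divr_gt0.
  have [l xl] := ta x _ e20; exists (lcomb b l); exists (e / 2) => // z.
  move=> [l' [xl' ->]]; rewrite -ball_normE /= -(norm_lcombB _ _ ab).
  rewrite -(subrKA x) [e]splitr (le_lt_trans (ler_normD _ _)) // ltrD //.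
  by rewrite distrC.
exists y => e e0.
have Fe : F (ball y e) by apply: Fy; exact: nbhsx_ballx.
have FBe : F (B e) by exists e.
have [z [yz [l [xl zE]]]] := filter_ex (filterI Fe FBe).
by exists l; split=> //; move: yz; rewrite -ball_normE zE.
Qed.

(** The closed graph is that of an everywhere defined isometric linear map; exchanging the two
    families shows that this map is onto. *)
Lemma isometric_extension a b : same_gram a b -> total a -> total b ->
  exists U : {linear H -> H}, unitary dot U /\ forall i, U (a i) = b i.
Proof.
move=> ab ta tb.
have /choice[u uP] : forall x, exists y, ext_graph a b x y.
  by move=> x; exact: ext_graph_total.
have u_lin : linear u.
  by move=> k x y; apply: (ext_graph_fun ab (uP _)); apply: ext_graph_linear.
pose U : {linear H -> H} := HB.pack u (GRing.isLinear.Build _ _ _ _ u u_lin).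
exists U; split; last first.
  move=> i; apply: (ext_graph_fun ab (uP _)) => e e0.
  by exists [:: (1, i)]; rewrite !lcomb1 !subrr normr0.
split=> [x y|y _]; last first.
  have ba : same_gram b a by move=> i j; rewrite ab.
  have [x yx] := ext_graph_total y ba tb; exists x => //.
  exact: ext_graph_fun ab (uP _) (ext_graph_sym yx).
have Unorm z : dot (U z) (U z) = dot z z.
  by rewrite !dotE (ext_graph_norm ab (uP z)).
exact: dot_polarization.
Qed.

End Extension.

Lemma linear_perturbation (U Q : {linear H -> H}) :
  exists S : {linear H -> H}, forall x, S x = U (x + Q x).
Proof.
pose s x := U (x + Q x).
have s_lin : linear s.
  by move=> k x y; rewrite /s !linearP addrACA -scalerDr linearP.
pose S : {linear H -> H} := HB.pack s (GRing.isLinear.Build _ _ _ _ s s_lin).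
by exists S.
Qed.

(** The unitary [U] extends [e v |-> e (g v)]; on the finitely many [e v] with [v] in [F], [Q] adds
    the preimage under [U] of the error [t v - e (g v)]. *)
Lemma perturbed_unitary (V : eqType) (e t : V -> H) (g gi : V -> V) (N : R[i])
    (F : set V) :
  0 < N -> (forall v w, dot (e v) (e w) = if v == w then N else 0) ->
  total e -> cancel g gi -> cancel gi g ->
  finite_set F -> (forall v, ~ F v -> t v = e (g v)) ->
  exists U Q : {linear H -> H}, [/\ unitary dot U, bounded_operator Q,
    finite_rank Q & forall v, U (e v + Q (e v)) = t v].
Proof.
move=> N0 eN te gK giK finF teg.
have N_neq0 : N != 0 by rewrite gt_eqF.
have [U [Uu Ue]] : exists U : {linear H -> H},
    unitary dot U /\ forall v, U (e v) = e (g v).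
  apply: (isometric_extension _ te).
    by move=> v w; rewrite !eN (can_eq gK).
  by apply: (total_span te) => v; exists [:: (1, gi v)]; rewrite lcomb1 /= giK.
have /choice[z zP] : forall v, exists z, U z = t v - e (g v).
  by move=> v; have [z _ Uz] := Uu.2 (t v - e (g v)) I; exists z.
have /finite_seqP[r0 FE] := finF; pose r := undup r0.
(* The scalar [dot x (e v) / N] is the coordinate of [x] along [e v]; [r] has no repetitions, so
   each correction enters once. *)
pose q x := \sum_(v <- r) (dot x (e v) / N) *: z v.
have q_lin : linear q.
  move=> k x y; rewrite /q scaler_sumr -big_split; apply: eq_bigr => v _ /=.
  by rewrite linearDl linearZl_LR /= mulrDl scalerDl scalerA mulrA.
pose Q : {linear H -> H} := HB.pack q (GRing.isLinear.Build _ _ _ _ q q_lin).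
have Qe v : Q (e v) = if v \in r then z v else 0.
  have small w : w != v -> (dot (e v) (e w) / N) *: z w = 0.
    by rewrite eN eq_sym => /negPf ->; rewrite mul0r scale0r.
  rewrite /Q /= /q; case: ifPn => [vr|vr].
    rewrite (bigD1_seq v) ?undup_uniq //= big1 ?addr0 => [|w /small//].
    by rewrite eN eqxx divff // scale1r.
  rewrite big_seq big1 // => w wr; apply: small.
  by apply: contraNneq vr => <-.
exists U, Q; split=> //.
- apply: (@bounded_operator_le _ (\sum_(v <- r) `|e v| / N * `|z v|)).
    by apply: sumr_ge0 => v _; rewrite !mulr_ge0 // invr_ge0 ltW.
  move=> x; rewrite mulr_suml (le_trans (ler_norm_sum _ _ _)) //.
  apply: ler_sum => v _; rewrite normrZ normrM normfV (gtr0_norm N0).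
  rewrite [leRHS]mulrAC ler_wpM2r // [leRHS]mulrAC.
  rewrite ler_wpM2r ?invr_ge0 ?(ltW N0) //.
  by rewrite mulrC dot_cauchy_schwarz.
- exists (size r), (fun i => z (tnth (in_tuple r) i)) => x.
  exists (fun i => dot x (e (tnth (in_tuple r) i)) / N).
  exact: big_tnth.
- move=> v; rewrite Qe; case: ifPn => [_|vr].
    by rewrite linearD Ue zP addrC subrK.
  rewrite addr0 Ue teg // FE /= => vr0.
  by move: vr; rewrite mem_undup vr0.
Qed.

End HilbertSpace.

(** * The orthogonal family attached to a root *)

Section RootedBasis.
Variables (R : realType) (V : choiceType) (adj : rel V).
Hypothesis tree : is_tree adj.
Variables (lambda : R) (H : completeNormedModType R[i]).
Variables (dot : {dot H for Num.conj}) (phi : V -> H).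
Hypothesis phiE : forall v w,
  dot (phi v) (phi w) = (lambda ^+ gdist adj v w)%:C%C.
Variables (o : V) (p : V -> V).
Hypothesis parent : is_parent adj o p.

(* At the root the factor gives [rooted phi o] the norm of the other vectors
   [rooted phi v]. *)
Definition rooted (psi : V -> H) (v : V) : H :=
  if v == o then (Num.sqrt (1 - lambda ^+ 2))%:C%C *: psi o
  else psi v - lambda%:C%C *: psi (p v).

Hypothesis lambda_lt1 : 0 < 1 - lambda ^+ 2.

(** Since [p v] is one step nearer to [w] than [v], the product of [phi v] with [phi w] is [lambda]
    times that of [phi (p v)]. *)
Lemma rooted_orthogonal_vertex v w : v <> o -> v <> w ->
  (gdist adj w o <= gdist adj v o)%N -> dot (rooted phi v) (phi w) = 0.
Proof.
move=> vo vw le_wv; rewrite /rooted; case: eqP => // _.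
rewrite linearBl linearZl_LR /= !phiE (gdist_parent tree parent vo vw le_wv).
by rewrite exprS rmorphM subrr.
Qed.

Lemma rooted_orthogonal v w : v <> w -> dot (rooted phi v) (rooted phi w) = 0.
Proof.
(* With [v] the deeper vertex, both [w] and [p w] satisfy the depth bound, so [rooted phi v] is
   orthogonal to both terms of [rooted phi w]. *)
wlog le_wv : v w / (gdist adj w o <= gdist adj v o)%N => [gen vw|vw].
  have [/gen->//|/ltnW/gen wv] := leqP (gdist adj w o) (gdist adj v o).
  by apply/eqP; rewrite herm_eq0C; apply/eqP/wv => wv'; exact: vw.
have vo : v <> o.
  move=> vo; apply: vw; rewrite vo; apply/esym/(gdist_eq0 tree)/eqP.
  by move: le_wv; rewrite vo gdistxx leqn0.
rewrite [X in dot _ X]/rooted; case: eqP => [wo|wo].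
  by rewrite linearZr_LR /= rooted_orthogonal_vertex ?mulr0 ?gdistxx.
have [_ dpw] := parent wo.
rewrite linearBr linearZr_LR /= !rooted_orthogonal_vertex ?mulr0 ?subrr //.
  by move=> vpw; move: le_wv; rewrite -dpw -vpw ltnn.
by rewrite (leq_trans _ le_wv) // -dpw.
Qed.

Lemma rooted_norm v :
  dot (rooted phi v) (rooted phi v) = (1 - lambda ^+ 2)%:C%C.
Proof.
rewrite [X in dot _ X]/rooted; case: eqP => [vo|vo].
  rewrite vo /rooted eqxx linearZl_LR linearZr_LR /= phiE gdistxx expr0.
  rewrite geC0_conj ?lecR ?sqrtr_ge0 // mulr1 -rmorphM /= -expr2.
  by rewrite sqr_sqrtr // ltW.
have [vp dpv] := parent vo.
(* The term at [p v] drops out by orthogonality, and the product with [phi v] is computed from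
   [gdist adj (p v) v = 1]. *)
rewrite linearBr linearZr_LR /= [X in _ * X]rooted_orthogonal_vertex //; first last.
- by rewrite -dpv.
- by move=> vpv; move: dpv; rewrite -vpv => /eqP; rewrite -[X in _ == X]add0n
    -[X in X == _]/(1 + _)%N eqn_add2r.
have pv1 : gdist adj (p v) v = 1%N.
  have [adjC adjxx _ _ _] := tree.
  have : (gdist adj (p v) v <= 1)%N.
    by rewrite (@gdist_le _ _ (p v) [:: v]) //= adjC vp.
  rewrite leq_eqVlt ltnS leqn0 => /orP[/eqP//|/eqP/(gdist_eq0 tree) pv].
  by move: vp; rewrite pv adjxx.
rewrite mulr0 subr0 /rooted; case: eqP => // _.
rewrite linearBl linearZl_LR /= !phiE gdistxx pv1 expr0 expr1.
by rewrite -rmorphM -rmorphB.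
Qed.

Lemma rooted_total : total phi -> total (rooted phi).
Proof.
move=> tphi; apply: (total_span tphi) => v.
have [n dv] : exists n, gdist adj v o = n by exists (gdist adj v o).
elim: n v dv => [v /(gdist_eq0 tree) ->|n IHn v dv].
  exists [:: (((Num.sqrt (1 - lambda ^+ 2))%:C%C)^-1, o)].
  rewrite /lcomb big_seq1 /rooted /= eqxx scalerA mulVf ?scale1r //.
  by rewrite fmorph_eq0 sqrtr_eq0 -ltNge.
have vo : v <> o by move=> vo; move: dv; rewrite vo gdistxx.
have [|l pvE] := IHn (p v).
  by apply: succn_inj; rewrite -dv; case: (parent vo).
exists ((1, v) :: [seq (lambda%:C%C * q.1, q.2) | q <- l]).
rewrite -cat1s lcomb_cat lcombZ lcomb1 -pvE /rooted.
by case: eqP => // _; rewrite subrK.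
Qed.

(** Induction on depth undoes the passage to the rooted family, the factor at the root being
    nonzero. The family [psi] is arbitrary, as [phi \o g] is needed. *)
Lemma linear_rooted (f : {linear H -> H}) psi :
  (forall v, f (rooted phi v) = rooted psi v) -> forall v, f (phi v) = psi v.
Proof.
move=> fE v.
have [n dv] : exists n, gdist adj v o = n by exists (gdist adj v o).
elim: n v dv => [v /(gdist_eq0 tree) ->|n IHn v dv].
  have := fE o; rewrite /rooted eqxx linearZ /= => /scalerI; apply.
  by rewrite fmorph_eq0 sqrtr_eq0 -ltNge.
have vo : v <> o by move=> vo; move: dv; rewrite vo gdistxx.
have dpv : gdist adj (p v) o = n.
  by apply: succn_inj; rewrite -dv; case: (parent vo).
have := fE v; rewrite /rooted; case: eqP => // _.
by rewrite linearB linearZ /= (IHn _ dpv) => /addIr.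
Qed.

End RootedBasis.

Unset Implicit Arguments.

Theorem theorem6p1 (R : realType) (V : choiceType) (adj : rel V)
  (hT : is_treeT adj)
  (lambda : R) (hlambda : -1 <= lambda <= 1)
  (H : completeNormedModType R[i]) (dot : {dot H for Num.conj}) (phi : V -> H)
  (hH : is_Hlambda adj lambda dot phi)
  (g : V -> V) (hg : Hier adj g)
  (hparity : lambda = -1 -> preserves_parity adj g) :
  exists sigma : {linear H -> H},
    [/\ bounded_operator sigma,
        forall v, sigma (phi v) = phi (g v)
      & exists U Q : {linear H -> H},
          [/\ unitary dot U, bounded_operator Q, finite_rank Q
            & forall x, sigma x = U (x + Q x)]].
Proof.
have [tree _] := hT; have [dotE phiE /dense_total tphi] := hH.
have [gi [gK giK]] := Hier_bij hg.
suff [U [Q [Uu Qb Qf UQ]]] : exists U Q : {linear H -> H},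
    [/\ unitary dot U, bounded_operator Q, finite_rank Q
      & forall v, U (phi v + Q (phi v)) = phi (g v)].
  have [S SE] := linear_perturbation U Q.
  exists S; split=> [|v|]; [|by rewrite SE UQ|by exists U, Q].
  apply/bounded_funP => r; have [M QM] := (bounded_funP Q).2 Qb r.
  exists (r + M) => x xr; rewrite SE.
  rewrite (@norm_eq_dot _ _ _ dotE _ (x + Q x)) ?Uu.1 //.
  by rewrite (le_trans (ler_normD _ _)) // lerD // QM.
have [gram|lambda_lt1] : (forall v w,
    lambda ^+ gdist adj (g v) (g w) = lambda ^+ gdist adj v w) \/
    0 < 1 - lambda ^+ 2.
  case/andP: hlambda => ge_m1 le_1.
  have [->|ne1] := eqVneq lambda 1; first by left => v w; rewrite !expr1n.
  have [lm1|ne_m1] := pselect (lambda = -1).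
    (* A power of -1 depends only on the parity of the exponent. *)
    by left => v w; rewrite lm1 -signr_odd (hparity lm1) signr_odd.
  right; rewrite -[1](expr1n _ 2) subr_sqr mulr_gt0 //.
    by rewrite subr_gt0 lt_neqAle ne1.
  by rewrite addrC -ltrBlDr sub0r lt_neqAle ge_m1 andbT; apply/eqP => /esym.
- have [U [Uu Uphi]] : exists U : {linear H -> H},
      unitary dot U /\ forall v, U (phi v) = phi (g v).
    apply: (isometric_extension dotE _ tphi).
      by move=> v w; rewrite !phiE gram.
    by apply: (total_span tphi) => v; exists [:: (1, gi v)]; rewrite lcomb1 /= giK.
  pose Q : {linear H -> H} := \0.
  exists U, Q; split=> //.
  + apply: (@bounded_operator_le _ _ _ 0) => // x.
    by rewrite normr0 mul0r.
  + by exists 0%N, (fun=> 0) => x; exists (fun=> 0); rewrite big_ord0.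
  + by move=> v; rewrite addr0.
have [_ _ [v0] _ _] := tree; have [p parent] := parent_exists tree v0.
have finF := finite_reversed_edges tree parent gK (Hier_adj hg parent)
  (fun v vo NW => contrapT (fun Nadj => NW (conj vo Nadj))).
have N0 : 0 < (1 - lambda ^+ 2)%:C%C :> R[i] by rewrite ltcR.
have gram v w : dot (rooted lambda v0 p phi v) (rooted lambda v0 p phi w) =
    if v == w then (1 - lambda ^+ 2)%:C%C else 0.
  case: eqP => [->|vw]; first exact: (rooted_norm tree phiE parent).
  exact: (rooted_orthogonal tree phiE parent vw).
have te := rooted_total tree parent lambda_lt1 tphi.
(* The target at [v] is built from [g v] and [g (p v)]; it agrees with the basis vector at [g v]
   when [p (g v) = g (p v)] and neither [v] nor [g v] is the root. *)
have [|U [Q [Uu Qb Qf UQ]]] := perturbed_unitary dotE N0 gram te gK giK finF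
    (t := rooted lambda v0 p (phi \o g)).
  move=> v /contrapT[vo gvo pgv]; rewrite /rooted /= pgv.
  by do 2 case: eqP => // _.
exists U, Q; split=> // v.
have [S SE] := linear_perturbation U Q; rewrite -SE.
apply: (linear_rooted tree parent lambda_lt1 (psi := phi \o g)) => w.
by rewrite SE UQ.
Qed.
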